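(* Let $\alpha: A\to C$ and $\beta: B\to C$ be homomorphisms of commutative rings with unity, with $\beta$ surjective, and let $D := \alpha\times_C\beta := \{(a,b)\in A\times B\mid \alpha(a)=\beta(b)\}$ be their fiber product, with projections $p_A: D\to A$ and $p_B: D\to B$. Let $H'\subsetneq H''$ be adjacent prime ideals of $D$ such that $H'\in\operatorname{Spec}(D)\setminus V(\operatorname{Ker}(p_A))$ and $H''\in V(\operatorname{Ker}(p_A))$. Then there exist two prime ideals $Q'\subsetneq Q''$ of $B$ such that $Q'\notin V(\operatorname{Ker}(\beta))$, $p_B^{-1}(Q')=H'$ and $p_B^{-1}(Q'')=H''$.
   Context: All rings are commutative with unity. $p_A$ and $p_B$ are the restrictions to $D$ of the projections of $A\times B$ onto $A$ and $B$. For an ideal $I$ of a ring $R$, $V(I)$ is the set of prime ideals of $R$ containing $I$. Two prime ideals $H'\subsetneq H''$ are adjacent if there is no prime ideal strictly between them. *)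

(* Defs.v *)
From HB Require Import structures.
From mathcomp Require Import all_boot all_algebra.
From mathcomp Require Import boolp classical_sets.

Set Implicit Arguments.
Unset Strict Implicit.
Unset Printing Implicit Defensive.

Import GRing.Theory.

Local Open Scope ring_scope.
Local Open Scope classical_set_scope.

(* The zero ring is allowed (comPzRingType), and ideals are Prop-valued sets
   because those of ring_quotient.v require 1 != 0; lemma prime_idealP below
   relates the two on nonzero rings. *)

Section Ideals.
Variable R : comPzRingType.
Implicit Types I P : set R.

Definition ideal I : Prop :=
  [/\ I 0, forall x y, I x -> I y -> I (x + y) &
      forall a x, I x -> I (a * x)].

Definition prime_ideal P : Prop :=
  [/\ ideal P, ~ P 1 & forall x y, P (x * y) -> P x \/ P y].

Definition Spec : set (set R) := [set P | prime_ideal P].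

Definition V I : set (set R) := [set P | Spec P /\ I `<=` P].

Definition adjacent (H' H'' : set R) : Prop :=
  [/\ Spec H', Spec H'', H' `<` H'' &
      ~ exists P, [/\ Spec P, H' `<` P & P `<` H'']].

End Ideals.

Arguments Spec : clear implicits.

Lemma prime_idealP (R : comNzRingType) (P : set R) :
  prime_ideal P <->
  idealr_closed (mem P : {pred R}) /\ prime_idealr_closed (mem P : {pred R}).
Proof.
split=> [[[P0 PD PM] P1 PP]|[[P0 P1 PM] PP]].
  split; first split.
  - exact: mem_set.
  - by apply/negP => /set_mem.
  - move=> a u v /set_mem Pu /set_mem Pv.
    by apply/mem_set; apply: PD => //; apply: PM.
  by move=> u v /set_mem /PP [] /mem_set -> //; rewrite orbT.
have cl a u v : P u -> P v -> P (a * u + v).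
  by move=> Pu Pv; apply: set_mem; apply: PM; apply: mem_set.
have Z : P 0 by apply: set_mem.
split.
- split=> // [x y Px Py|a x Px]; first by rewrite -[x]mul1r; apply: cl.
  by rewrite -[_ * _]addr0; apply: cl.
- by move=> /mem_set; apply/negP.
- by move=> x y /mem_set /PP /orP[] /set_mem; [left|right].
Qed.

Definition ker (R S : comPzRingType) (f : {rmorphism R -> S}) : set R :=
  f @^-1` [set 0].

Section FiberProduct.
Variables (A B C : comPzRingType).
Variables (alpha : {rmorphism A -> C}) (beta : {rmorphism B -> C}).

Definition fiber_pred : {pred A * B} := [pred x | alpha x.1 == beta x.2].

Fact fiber_subring_closed : subring_closed fiber_pred.
Proof.
split=> [|x y|x y]; rewrite !inE /= ?rmorph1 //.
  by move=> /eqP ex /eqP ey; rewrite !rmorphB /= ex ey.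
by move=> /eqP ex /eqP ey; rewrite !rmorphM /= ex ey.
Qed.

HB.instance Definition _ :=
  GRing.isSubringClosed.Build (A * B)%type fiber_pred fiber_subring_closed.

Record fiber_product : Type :=
  FiberProduct { fiber_val : A * B; _ : fiber_val \in fiber_pred }.

HB.instance Definition _ := [isSub for fiber_val].
HB.instance Definition _ := [Choice of fiber_product by <:].
HB.instance Definition _ :=
  GRing.SubChoice_isSubComPzRing.Build (A * B)%type fiber_pred fiber_product
    (GRing.subringClosedP fiber_pred).

Definition fiber_fst : fiber_product -> A := fst \o val.
Definition fiber_snd : fiber_product -> B := snd \o val.

HB.instance Definition _ := GRing.RMorphism.on fiber_fst.
HB.instance Definition _ := GRing.RMorphism.on fiber_snd.

End FiberProduct.

Arguments fiber_fst {A B C} alpha beta _.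
Arguments fiber_snd {A B C} alpha beta _.

(* Main.v *)
(* Let J = Ker(beta), so that Ker(p_A) = 0 x J.  For d0 = (0, j0) in Ker(p_A)
   outside H', the prime Q' = {b | (0, j0 b) in H'} of B contracts to H'.
   The ideal J + Q' of B is disjoint from p_B(D \ H''): if p_B(d) = j + q then
   d - (0, j) is in H' and (0, j) is in H''.  A prime Q'' of B containing J + Q'
   and disjoint from p_B(D \ H'') contracts to a prime between H' and H'' which
   contains Ker(p_A), hence differs from H'; by adjacency it is H''. *)

Require Import Defs.
From HB Require Import structures.
From mathcomp Require Import all_boot all_algebra.
From mathcomp Require Import boolp classical_sets.
From mathcomp Require Import ring.

Set Implicit Arguments.
Unset Strict Implicit.
Unset Printing Implicit Defensive.

Import GRing.Theory.

Local Open Scope ring_scope.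
Local Open Scope classical_set_scope.

Section Ideals.
Variable R : comPzRingType.
Implicit Types I P S : set R.

Lemma ideal_add_principal I x :
  ideal I -> ideal [set z | exists m a, I m /\ z = m + a * x].
Proof.
case=> I0 ID IM; split.
- by exists 0, 0; rewrite mul0r addr0.
- move=> _ _ [m [a [Im ->]]] [n [b [In ->]]].
  by exists (m + n), (a + b); split; [exact: ID | ring].
- move=> c _ [m [a [Im ->]]].
  by exists (c * m), (c * a); split; [exact: IM | ring].
Qed.

Lemma exists_maximal_ideal_disjoint I S :
  ideal I -> I `&` S `<=` set0 ->
  exists M, [/\ ideal M, I `<=` M, M `&` S `<=` set0 &
    forall N, ideal N -> M `<` N -> exists2 s, N s & S s].
Proof.
move=> idI IS.
(* Adjoining I keeps the empty chain bounded. *)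
pose good X := ideal (X `|` I) /\ (X `|` I) `&` S `<=` set0.
have good0 : good set0 by rewrite /good set0U.
have [F Fgood Ftot|A [[idA AS] Amax]] := @Zorn_bigcup R good.
  (* With [set0] adjoined, every element of the union with [I] lies in [X]|[I] for a single [X] in
     [G], even if [F] is empty. As [G] is still a chain, any two elements share such an [X]. *)
  pose G := F `|` [set set0].
  have Ggood X : G X -> good X by case=> [/Fgood|->].
  have Gtot X Y : G X -> G Y -> X `<=` Y \/ Y `<=` X.
    case=> [FX|->] [FY|->]; [exact: Ftot | right | left | left] => //.
  have UG x : (\bigcup_(X in F) X `|` I) x -> exists2 X, G X & (X `|` I) x.
    by case=> [[X FX Xx]|Ix]; [exists X; left | exists set0; right].
  have GU X x : G X -> (X `|` I) x -> (\bigcup_(X in F) X `|` I) x.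
    by move=> + [Xx|Ix]; [case=> [FX|X0]; [left; exists X | rewrite X0 in Xx]
                         | right].
  split; last first.
    by move=> x [/UG[X GX Xx] Sx]; have [_] := Ggood _ GX; apply; split; eauto.
  split.
  - by right; case: idI.
  - move=> x y /UG[X GX Xx] /UG[Y GY Yy].
    have [XY|YX] := Gtot _ _ GX GY.
      apply: (GU Y) => //; have [[_ D _] _] := Ggood _ GY.
      by apply: D => //; case: Xx; [left; exact: XY | right].
    apply: (GU X) => //; have [[_ D _] _] := Ggood _ GX.
    by apply: D => //; case: Yy; [left; exact: YX | right].
  - move=> a x /UG[X GX Xx]; apply: (GU X) => //.
    by have [[_ _ M] _] := Ggood _ GX; apply: M.
exists (A `|` I); split=> //.
move=> N idN [AN NA].
(* Since [N] contains [A]|[I], adjoining [I] leaves it unchanged. Were [N] disjoint from [S], it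
   would be a good set strictly above [A]. *)
apply: contrapT => NS; apply: (Amax N).
  split=> [x Ax|NsubA]; first by apply: AN; left.
  by apply: NA => x /NsubA; left.
have -> : good N = (ideal N /\ N `&` S `<=` set0).
  by rewrite /good setUidl // => x Ix; apply: AN; right.
by split=> // x [Nx Sx]; apply: NS; exists x.
Qed.

(** An ideal [P] maximal among those disjoint from [S] is prime: if neither [x] nor [y] is in [P],
    both [P + (x)] and [P + (y)] meet [S]. The product of the two elements found is in [S], and it
    would be in [P] if [x * y] were. *)
Lemma exists_prime_disjoint I S :
  ideal I -> S 1 -> (forall x y, S x -> S y -> S (x * y)) ->
  I `&` S `<=` set0 ->
  exists P, [/\ prime_ideal P, I `<=` P & P `&` S `<=` set0].
Proof.
move=> idI S1 SM /(exists_maximal_ideal_disjoint idI)[P [idP IP PS Pmax]].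
have [P0 PD PM] := idP.
exists P; split=> //; split=> // [P1|x y Pxy]; first exact: (PS 1).
have ext z : ~ P z -> exists m a, P m /\ S (m + a * z).
  move=> Pz; have [|_ [m [a [Pm ->]]] Ss] :=
    Pmax _ (ideal_add_principal z idP); last by exists m, a.
  split=> [w Pw|sub]; first by exists w, 0; rewrite mul0r addr0.
  by apply/Pz/sub; exists 0, 1; rewrite add0r mul1r.
apply: contrapT => /not_orP[/ext[m [a [Pm Sx]]] /ext[n [b [Pn Sy]]]].
apply: (PS ((m + a * x) * (n + b * y))); split; last exact: SM.
have -> : (m + a * x) * (n + b * y) =
    (n + b * y) * m + (a * x * n + a * b * (x * y)) by ring.
by apply: (PD); [|apply: PD]; apply: PM.
Qed.

End Ideals.

Lemma prime_ideal_preimage (R S : comPzRingType) (f : {rmorphism R -> S})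
    (P : set S) :
  prime_ideal P -> prime_ideal (f @^-1` P).
Proof.
case=> -[P0 PD PM] P1 PP; split; first split.
- by rewrite /= rmorph0.
- by move=> x y /= Px Py; rewrite rmorphD; apply: PD.
- by move=> a x /= Px; rewrite rmorphM; apply: PM.
- by rewrite /= rmorph1.
- by move=> x y /=; rewrite rmorphM => /PP.
Qed.

Section FiberProductPrimes.
Variables (A B C : comPzRingType).
Variables (alpha : {rmorphism A -> C}) (beta : {rmorphism B -> C}).
Local Notation D := (fiber_product alpha beta).
Local Notation pA := (fiber_fst alpha beta).
Local Notation pB := (fiber_snd alpha beta).

Lemma fiber_eq (d e : D) : pA d = pA e -> pB d = pB e -> d = e.
Proof.
move=> h1 h2; apply: val_inj; move: h1 h2; rewrite /fiber_fst /fiber_snd /=.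
by case: (\val d) (\val e) => [? ?] [? ?] /= -> ->.
Qed.

Lemma fiber_comm (d : D) : alpha (pA d) = beta (pB d).
Proof. by apply/eqP; exact: (valP d). Qed.

Fact fiber_inr_subproof (b : B) : beta b = 0 -> (0, b) \in fiber_pred alpha beta.
Proof. by move=> b0; rewrite inE /= rmorph0 b0. Qed.

Definition fiber_inr b (b0 : beta b = 0) : D :=
  FiberProduct (fiber_inr_subproof b0).

Lemma ker_fiber_fst (d : D) : pA d = 0 -> beta (pB d) = 0.
Proof. by move=> d0; rewrite -fiber_comm d0 rmorph0. Qed.

(** Multiplication by [pB d0] sends all of [B] into Ker(beta), hence lifts to a map [scale] from [B]
    to [D]. It is additive, and multiplicative up to a factor [d0], which can be cancelled modulo
    the prime [H]. *)
Lemma exists_prime_over (H : set D) :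
  prime_ideal H -> ~ (ker pA `<=` H) ->
  exists Q, [/\ prime_ideal Q, ~ (ker beta `<=` Q) & pB @^-1` Q = H].
Proof.
move=> [[H0 HD HM] H1 HP] /existsNP[d0 /not_implyP[d0A Hd0]].
have j0 := ker_fiber_fst d0A.
have scale0 b : beta (pB d0 * b) = 0 by rewrite rmorphM j0 mul0r.
pose scale b : D := fiber_inr (scale0 b).
have scaleE d : scale (pB d) = d0 * d.
  by apply: fiber_eq; rewrite rmorphM /= ?d0A ?mul0r.
have scaleD x y : scale (x + y) = scale x + scale y.
  apply: fiber_eq; rewrite rmorphD /=; first by rewrite addr0.
  by rewrite /fiber_snd /= mulrDr.
have scaleM x y : d0 * scale (x * y) = scale x * scale y.
  apply: fiber_eq; rewrite !rmorphM /=; first by rewrite !mulr0.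
  by rewrite /fiber_snd /=; ring.
have HQ d : H (d0 * d) -> H d by case/HP.
exists (scale @^-1` H); split.
- split; first split.
  + by rewrite /= -(rmorph0 pB) scaleE mulr0.
  + by move=> x y; rewrite /= scaleD; apply: HD.
  (* Here [a] is any element of [B], possibly outside the image of [pB]. The extra factor [d0] turns
     [scale (a * x)] into a multiple of [scale x] in [D]. *)
  + by move=> a x Qx /=; apply: HQ; rewrite scaleM; apply: HM.
  + by rewrite /= -(rmorph1 pB) scaleE mulr1.
  + by move=> x y /= Qxy; apply: HP; rewrite -scaleM; apply: HM.
(* The witness is [pB d0]: its image under [scale] is [d0 * d0], which is not in [H]. *)
- by move=> /(_ _ j0); rewrite /= scaleE => /HQ.
- apply/seteqP; split=> d /=; rewrite scaleE; first exact: HQ.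
  exact: HM.
Qed.

End FiberProductPrimes.

Theorem proposition2p7 (A B C : comPzRingType)
    (alpha : {rmorphism A -> C}) (beta : {rmorphism B -> C})
    (beta_surj : forall c : C, exists b : B, beta b = c)
    (H' H'' : set (fiber_product alpha beta))
    (H_adj : adjacent H' H'')
    (H'_notin : (Spec (fiber_product alpha beta)
                   `\` V (ker (fiber_fst alpha beta))) H')
    (H''_in : V (ker (fiber_fst alpha beta)) H'') :
  exists Q' Q'' : set B,
    [/\ Spec B Q', Spec B Q'', Q' `<` Q'' & ~ V (ker beta) Q'] /\
    (fiber_snd alpha beta @^-1` Q' = H' /\
     fiber_snd alpha beta @^-1` Q'' = H'').
Proof.
set pB : {rmorphism _ -> B} := fiber_snd alpha beta.
have [primeH' [[_ H''D _] H''1 H''P] [H'H'' nH''H'] between] := H_adj.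
have [_ KH''] := H''_in.
have KH' : ~ (ker (fiber_fst alpha beta) `<=` H').
  by have [_ nV] := H'_notin => K; apply: nV.
have [Q' [primeQ' nQ' Q'H']] := exists_prime_over primeH' KH'.
have [idQ' _ _] := primeQ'; have [Q'0 Q'D Q'M] := idQ'.
(* This is the sum J + Q', written as the preimage under [beta] of the image of [Q']. *)
pose I := [set b | exists2 q, Q' q & beta b = beta q].
pose S := pB @` ~` H''.
have idI : ideal I.
  split; first by exists 0.
  - move=> x y [q Qq xq] [r Qr yr].
    by exists (q + r); [exact: Q'D | rewrite !rmorphD xq yr].
  - move=> a x [q Qq xq].
    by exists (a * q); [exact: Q'M | rewrite !rmorphM xq].
have S1 : S 1 by exists 1 => //; rewrite rmorph1.
have SM x y : S x -> S y -> S (x * y).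
  move=> [d Hd <-] [e He <-]; exists (d * e); last by rewrite rmorphM.
  by case/H''P.
have IS : I `&` S `<=` set0.
  move=> b [[q Qq dq] [d Hd eq_d]]; rewrite -eq_d in dq.
  have j0 : beta (pB d - q) = 0 by rewrite rmorphB dq subrr.
  pose e : fiber_product alpha beta := fiber_inr alpha j0.
  have He : H'' e by exact: KH''.
  (* Split [d] as [(d - e) + e]: the [B]-component of [d - e] is [q], so [d - e] lies in the
     preimage of [Q'], which is [H']. *)
  apply: Hd; rewrite -(subrK e d); apply: H''D => //; apply: H'H''.
  rewrite -Q'H' /= rmorphB.
  suff -> : pB d - pB e = q by [].
  by rewrite [pB e]/(pB d - q) opprB addrC subrK.
have [Q'' [primeQ'' IQ'' Q''S]] := exists_prime_disjoint idI S1 SM IS.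
have Q'Q'' : Q' `<=` Q'' by move=> q Qq; apply: IQ''; exists q.
have Q''H'' : pB @^-1` Q'' `<=` H''.
  move=> d Qd; apply: contrapT => Hd.
  by apply: (Q''S (pB d)); split=> //; exists d.
have KQ'' : ker (fiber_fst alpha beta) `<=` pB @^-1` Q''.
  by move=> d /ker_fiber_fst d0; apply: IQ''; exists 0; rewrite ?rmorph0.
have H'Q'' : H' `<` pB @^-1` Q''.
  split=> [|sub]; first by rewrite -Q'H' => d /Q'Q''.
  by apply: KH' => d /KQ''/sub.
have Q''E : pB @^-1` Q'' = H''.
  apply/seteqP; split=> //; apply: contrapT => nsub; apply: between.
  by exists (pB @^-1` Q''); split=> //; apply: prime_ideal_preimage.
exists Q', Q''; split; last by [].
split=> //; last by case.
(* If [Q''] were contained in [Q'], taking preimages under [pB] would put [H''] inside [H']. *)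
split=> // sub; apply: nH''H'.
by rewrite -Q''E -Q'H' => d /sub.
Qed.
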